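(* Let $H\in\mathbb{N}$, $\alpha\in\mathbb{R}$, and let $\mathcal{L}_\infty$, $\mathcal{G}$, $V$ be as in the context. Let $\gamma\in(0,\infty)$ and let $\Theta=(\Theta_n)_{n\in\mathbb{N}_0}\colon\mathbb{N}_0\to\mathbb{R}^{3H+1}$ satisfy for all $n\in\mathbb{N}_0$ that $\Theta_{n+1}=\Theta_n-\gamma\,\mathcal{G}(\Theta_n)$, and assume $\gamma\le(4V(\Theta_0)+2)^{-1}$. Then for all $n\in\mathbb{N}_0$ it holds that $$V(\Theta_{n+1})-V(\Theta_n)\le-4\gamma\,\mathcal{L}_\infty(\Theta_n)\le0.$$
   Context: $\mathbb{N}=\{1,2,\dots\}$, $\mathbb{N}_0=\{0,1,2,\dots\}$. Fix $H\in\mathbb{N}$, $\alpha\in\mathbb{R}$. For $r\in[1,\infty)$, $x\in\mathbb{R}$ let $\sigma_r(x)=r^{-1}\ln(1+r^{-1}e^{rx})$, and let $\sigma_\infty(x)=\max\{x,0\}$. For $r\in[1,\infty]$, $\phi=(\phi_1,\dots,\phi_{3H+1})\in\mathbb{R}^{3H+1}$, $x\in\mathbb{R}$ let $\mathscr{N}_r^{\phi}(x)=\phi_{3H+1}+\sum_{j=1}^{H}\phi_{2H+j}\,\sigma_r(\phi_jx+\phi_{H+j})$ and $\mathcal{L}_r(\phi)=\int_0^1(\mathscr{N}_r^{\phi}(y)-\alpha)^2\,dy$. The function $\mathcal{G}\colon\mathbb{R}^{3H+1}\to\mathbb{R}^{3H+1}$ satisfies $\mathcal{G}(\phi)=\lim_{r\to\infty}(\nabla\mathcal{L}_r)(\phi)$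 for every $\phi$ for which the sequence $((\nabla\mathcal{L}_r)(\phi))_{r\in\mathbb{N}}$ converges. $\|\cdot\|$ is the Euclidean norm. $V\colon\mathbb{R}^{3H+1}\to\mathbb{R}$ is given by $V(\phi)=\|\phi\|^2+(\phi_{3H+1}-2\alpha)^2$. *)

(* Defs.v *)
From mathcomp Require Import all_boot all_order all_algebra.
From mathcomp Require Import all_classical all_reals all_analysis.
Set Implicit Arguments.
Unset Strict Implicit.
Unset Printing Implicit Defensive.
Import Order.TTheory GRing.Theory Num.Theory.
Import numFieldNormedType.Exports.
Local Open Scope classical_set_scope.
Local Open Scope ring_scope.

(* Coordinates are numbered from 1: [coord phi j] is phi_j for 1 <= j <= n.+1.
   The value for j outside this range is never used. *)
Definition coord (R : realType) (n : nat) (phi : 'rV[R]_n.+1) (j : nat) : R :=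
  phi ord0 (inord j.-1).

(* Only the parameters r with 1 <= r <= +oo are meaningful; in particular the
   value at r = -oo is irrelevant. *)
Definition sigma (R : realType) (r : \bar R) (x : R) : R :=
  match r with
  | r%:E => r^-1 * ln (1 + r^-1 * expR (r * x))
  | _ => Num.max x 0
  end.

Definition network (R : realType) (H : nat) (r : \bar R)
    (phi : 'rV[R]_(3 * H).+1) (x : R) : R :=
  coord phi (3 * H + 1) +
  \sum_(1 <= j < H.+1)
     coord phi (2 * H + j) * sigma r (coord phi j * x + coord phi (H + j)).

Definition risk (R : realType) (H : nat) (alpha : R) (r : \bar R)
    (phi : 'rV[R]_(3 * H).+1) : R :=
  Rintegral (@lebesgue_measure R) `[0, 1]
    (fun y : R => (network r phi y - alpha) ^+ 2).

Definition gradient (R : realType) (n : nat) (f : 'rV[R]_n -> R)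
    (phi : 'rV[R]_n) : 'rV[R]_n :=
  \row_(i < n) derive f phi (delta_mx ord0 i).

(* The library norm on row vectors is the maximum norm. *)
Definition euclidean_norm (R : realType) (n : nat) (phi : 'rV[R]_n) : R :=
  Num.sqrt (\sum_(i < n) phi ord0 i ^+ 2).

Definition lyapunov (R : realType) (H : nat) (alpha : R)
    (phi : 'rV[R]_(3 * H).+1) : R :=
  euclidean_norm phi ^+ 2 + (coord phi (3 * H + 1) - 2 * alpha) ^+ 2.

(* The sequence ((nabla L_r)(phi)) over the positive integers r = n + 1. *)
Definition risk_gradients (R : realType) (H : nat) (alpha : R)
    (phi : 'rV[R]_(3 * H).+1) (n : nat) : 'rV[R]_(3 * H).+1 :=
  gradient (risk alpha (n.+1%:R)%:E) phi.

(* G is constrained only where the sequence converges; elsewhere it is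
   arbitrary. *)
Definition generalized_gradient (R : realType) (H : nat) (alpha : R)
    (G : 'rV[R]_(3 * H).+1 -> 'rV[R]_(3 * H).+1) : Prop :=
  forall phi : 'rV[R]_(3 * H).+1,
    cvgn (risk_gradients alpha phi) -> G phi = limn (risk_gradients alpha phi).

(* Main.v *)
(* The limit of the risk gradients is G_i = int_0^1 2 (N - alpha) D(e_i), where
   N is the ReLU network and D(u) is its formal derivative in direction u, with
   the Heaviside function as derivative of the ReLU: differentiate under the
   integral sign for finite r and let r tend to infinity by dominated
   convergence, with bounds uniform in r.  Since max(z,0) = 1_{z>0} z, one has
   D(phi) + (c - 2 alpha) = 2 (N - alpha) for the output bias c of phi, so the
   gradients of V and L_oo have inner product 8 L_oo.  The Cauchy-Schwarz bound
   D(u)^2 <= |u|^2 (1 + 2 |phi|^2) gives |G|^2 <= 4 (1 + 2 |phi|^2) L_oo, and V is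
   a quadratic polynomial, so for small gamma the second-order term is at most
   half of the first-order one; V decreases, hence gamma stays small enough. *)
Require Import Defs.
From mathcomp Require Import all_boot all_order all_algebra.
From mathcomp Require Import all_classical all_reals all_analysis measurable_realfun.
From mathcomp Require Import ring lra zify.
Set Implicit Arguments.
Unset Strict Implicit.
Unset Printing Implicit Defensive.
Import Order.TTheory GRing.Theory Num.Theory.
Import numFieldNormedType.Exports.
Local Open Scope classical_set_scope.
Local Open Scope ring_scope.
(* [coord] would otherwise denote the function of the vector library. *)
Import Defs.

(** * Calculus preliminaries *)

Lemma is_derive1_comp (R : realType) (f g : R -> R) (x df dg : R) :
  is_derive x 1 g dg -> is_derive (g x) 1 f df ->
  is_derive x 1 (f \o g) (df * dg).
Proof.
move=> [gx gE] [fx fE]; apply: DeriveDef.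
  move/derivable1_diffP : gx => gx; move/derivable1_diffP : fx => fx.
  exact/derivable1_diffP/(differentiable_comp gx fx).
rewrite -derive1E (derive1_comp gx fx).
by rewrite derive1E fE derive1E gE.
Qed.

(** Square the bound exp(y/2) >= 1 + y/2. The quadratic growth is what lets exp(r t) dominate r in
    the limits below. *)
Lemma expR_ge_sqr (R : realType) (y : R) : 0 <= y -> y ^+ 2 / 4 <= expR y.
Proof.
move=> y0; have -> : y = y / 2 + y / 2 by lra.
rewrite expRD; have := expR_ge1Dx (y / 2).
by set e := expR _ => ?; nra.
Qed.

(** * The smooth activations and their ReLU limit *)

Section activation.
Context {R : realType}.
Implicit Types (r z : R) (s ds : R -> R).

Definition dsigma r z : R := expR (r * z) / (r + expR (r * z)).

(** The value 0 at 0 is the limit of [dsigma r 0] = 1 / (r + 1). *)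
Definition heaviside z : R := if 0 < z then 1 else 0.

(* The properties of an activation [s] and of its (generalized) derivative [ds]
   which make all the integrals below exist, with bounds independent of r. *)
Definition admissible s ds :=
  [/\ measurable_fun setT s, measurable_fun setT ds,
      forall z, `|s z| <= 1 + `|z| & forall z, `|ds z| <= 1].

Lemma sigma_arg_gt0 r z : 0 < r -> 0 < 1 + r^-1 * expR z.
Proof.
by move=> r0; rewrite ltr_pwDl// mulr_ge0 ?expR_ge0// invr_ge0 ltW.
Qed.

Lemma sigma_derive r z : 0 < r -> is_derive z 1 (sigma r%:E) (dsigma r z).
Proof.
move=> r0.
have d1 : is_derive z 1 (fun y : R => r * y) r.
  by have := is_deriveZ r (is_derive_id z (1 : R)); rewrite /GRing.scale/= mulr1.
have d2 := is_derive1_comp d1 (is_derive_expR (r * z)).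
have d3 : is_derive z 1 (fun y : R => 1 + r^-1 * expR (r * y))
    (r^-1 * (expR (r * z) * r)).
  have := is_deriveD (is_derive_cst (1 : R) z 1) (is_deriveZ r^-1 d2).
  by rewrite add0r.
have d4 := is_derive1_comp d3 (is_derive1_ln (sigma_arg_gt0 (r * z) r0)).
have := is_deriveZ r^-1 d4; congr (is_derive _ _ _ _).
rewrite /GRing.scale/= /dsigma.
have := sigma_arg_gt0 (r * z) r0; set e := expR _ => ee0.
field; have := expR_gt0 (r * z); rewrite -/e => {}ee.
by rewrite !gt_eqF// addr_gt0.
Qed.

Lemma dsigma_ge0 r z : 0 < r -> 0 <= dsigma r z.
Proof. by move=> r0; rewrite divr_ge0 ?expR_ge0// addr_ge0 ?expR_ge0 ?ltW. Qed.

Lemma dsigma_le1 r z : 0 < r -> dsigma r z <= 1.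
Proof.
move=> r0; have e0 := expR_gt0 (r * z).
by rewrite /dsigma ler_pdivrMr ?addr_gt0// mul1r lerDr ltW.
Qed.

Lemma sigma_ge0 r z : 0 < r -> 0 <= sigma r%:E z.
Proof.
move=> r0; apply: mulr_ge0; first by rewrite invr_ge0 ltW.
by rewrite ln_ge0// lerDl mulr_ge0 ?expR_ge0 ?invr_ge0 ?ltW.
Qed.

(** Multiplying by r and exponentiating removes the logarithm; this criterion and [sigma_ge] turn
    bounds on [sigma] into comparisons of exponentials. *)
Lemma sigma_le r z c : 0 < r -> 1 + r^-1 * expR (r * z) <= expR (r * c) ->
  sigma r%:E z <= c.
Proof.
move=> r0 h; rewrite /sigma mulrC ler_pdivrMr// -ler_expR.
by rewrite lnK ?posrE ?sigma_arg_gt0// [c * _]mulrC.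
Qed.

Lemma sigma_ge r z c : 0 < r -> expR (r * c) <= 1 + r^-1 * expR (r * z) ->
  c <= sigma r%:E z.
Proof.
move=> r0 h; rewrite /sigma mulrC ler_pdivlMr// -ler_expR.
by rewrite lnK ?posrE ?sigma_arg_gt0// [c * _]mulrC.
Qed.

Lemma sigma_admissible r : 1 <= r -> admissible (sigma r%:E) (dsigma r).
Proof.
move=> r1; have r0 : 0 < r by exact: lt_le_trans r1.
split.
- apply: continuous_measurable_fun => z.
  apply/differentiable_continuous/derivable1_diffP.
  by have [] := sigma_derive z r0.
- apply: continuous_measurable_fun => z.
  have ce : {for z, continuous (fun y : R => expR (r * y))}.
    apply: (@continuous_comp _ _ _ (fun y : R => r * y) expR).
      exact: mulrl_continuous.
    exact: continuous_expR.
  apply: cvgM; first exact: ce.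
  apply: cvgV; first by rewrite gt_eqF// addr_gt0// expR_gt0.
  by apply: cvgD; [exact: cvg_cst|exact: ce].
(* The target is 1 + exp(r z) / r <= exp(r) exp(r |z|). Both summands are at most exp(r |z|), and
   exp(r) >= 1 + r >= 2. *)
- move=> z; rewrite ger0_norm ?sigma_ge0//; apply: sigma_le => //.
  have h1 : expR (r * z) <= expR (r * `|z|) by rewrite ler_expR ler_pM2l// ler_norm.
  have h2 : 1 <= expR (r * `|z|).
    by rewrite -[X in X <= _]expR0 ler_expR mulr_ge0// ltW.
  have h3 : 2 <= expR r.
    by rewrite (le_trans _ (expR_ge1Dx r))// -[leLHS]/(1 + 1 : R) lerD2l.
  rewrite mulrDr mulr1 expRD.
  apply: (@le_trans _ _ (2 * expR (r * `|z|))); last first.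
    by rewrite ler_pM2r ?expR_gt0.
  rewrite mulr_natl mulr2n lerD// (le_trans _ h1)// ler_piMl ?expR_ge0//.
  by rewrite invf_le1.
- by move=> z; rewrite ger0_norm ?dsigma_ge0// dsigma_le1.
Qed.

Lemma relu_admissible : admissible (sigma (+oo%E : \bar R)) heaviside.
Proof.
split.
- apply: measurable_funrpos => //.
- rewrite (_ : heaviside = \1_[set z | 0 < z]).
    by apply: measurable_indic; rewrite -set_itvoy; exact: measurable_itv.
  apply/funext => z; rewrite indicE /heaviside.
  by case: ifPn => z0; [rewrite mem_set|rewrite memNset//; exact/negP].
- by move=> z; rewrite /sigma; case: (leP z 0) => _; rewrite ?normr0 ?addr_ge0 ?lerDr.
- by move=> z; rewrite /heaviside; case: (0 < z); rewrite ?normr1 ?normr0.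
Qed.

(** After exponentiation, the upper bound follows from 1 + exp(r z) / r <= 2 exp(r max(z,0)) and 2
    <= exp(r e); the lower bound is immediate for z <= 0 and needs r <= exp(r e) for z > 0. *)
Lemma sigma_cvg z : sigma (n.+1%:R)%:E z @[n --> \oo] --> sigma +oo%E z.
Proof.
apply/cvgrPdist_le => e e0; near=> n.
set r : R := n.+1%:R; have r1 : 1 <= r by rewrite ler1n.
have r0 : 0 < r by exact: lt_le_trans r1.
have h1 : r^-1 <= e.
  rewrite invf_ple// (le_trans _ (_ : n%:R <= r)) ?ler_nat//.
  by near: n; exact: nbhs_infty_ger.
(* This threshold says r <= (r e)^2 / 4, hence r <= exp(r e) by [expR_ge_sqr]. *)
have h2 : 4 / e ^+ 2 <= r.
  rewrite (le_trans _ (_ : n%:R <= r)) ?ler_nat//.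
  by near: n; exact: nbhs_infty_ger.
have re : 1 <= r * e by rewrite -ler_pdivrMl// mulr1.
have h3 : r <= expR (r * e).
  apply: le_trans (expR_ge_sqr (mulr_ge0 (ltW r0) (ltW e0))).
  move: h2; rewrite ler_pdivrMr ?exprn_gt0// => h2; nra.
rewrite ler_distlC; apply/andP; split; rewrite /sigma -/(sigma r%:E z).
  case: (leP z 0) => z0.
    by rewrite (@le_trans _ _ 0)// ?subr_le0 ?sigma_ge0// ltW.
  apply: sigma_ge => //; rewrite mulrBr expRD expRN mulrC.
  rewrite (@le_trans _ _ (r^-1 * expR (r * z)))// ?lerDr//.
  by rewrite ler_pM2r ?expR_gt0// lef_pV2 ?posrE// expR_gt0.
apply: sigma_le => //.
have ee : 2 <= expR (r * e) by rewrite (le_trans _ (expR_ge1Dx _))//; lra.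
have ra : r^-1 * expR (r * z) <= expR (r * z).
  by rewrite ler_piMl ?expR_ge0// invf_le1.
rewrite mulrDr expRD; case: (leP z 0) => z0.
  have : expR (r * z) <= 1 by rewrite -expR0 ler_expR pmulr_rle0.
  rewrite mulr0 expR0 mul1r => a1; apply: le_trans ee.
  by rewrite -[leRHS]/(1 + 1 : R) lerD2l (le_trans ra).
have a1 : 1 <= expR (r * z) by rewrite -[leLHS]expR0 ler_expR mulr_ge0 ?ltW.
apply: le_trans (lerD a1 ra) _.
by rewrite -mulr2n -mulr_natr ler_pM2l ?expR_gt0.
Unshelve. all: by end_near. Qed.

(** With a = exp(r z): for z > 0 the error is r / (r + a), and a >= (r z)^2 / 4 outgrows r; for z <=
    0 the error is a / (r + a) <= 1 / r, since a <= 1. *)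
Lemma dsigma_cvg z : dsigma n.+1%:R z @[n --> \oo] --> heaviside z.
Proof.
apply/cvgrPdist_le => e e0; near=> n.
set r : R := n.+1%:R; have r1 : 1 <= r by rewrite ler1n.
have r0 : 0 < r by exact: lt_le_trans r1.
have a0 := expR_gt0 (r * z).
rewrite /heaviside; case: (ltP 0 z) => z0 /=.
  have h2 : 4 / (e * z ^+ 2) <= r.
    rewrite (le_trans _ (_ : n%:R <= r)) ?ler_nat//.
    by near: n; exact: nbhs_infty_ger.
  rewrite ger0_norm ?subr_ge0 ?dsigma_le1// /dsigma.
  have := expR_ge_sqr (mulr_ge0 (ltW r0) (ltW z0)).
  move: h2; rewrite ler_pdivrMr ?mulr_gt0 ?exprn_gt0//.
  set a := expR _ in a0 * => h2 h3.
  have -> : 1 - a / (r + a) = r / (r + a) by field; rewrite gt_eqF// addr_gt0.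
  rewrite ler_pdivrMr ?addr_gt0//.
  have : r <= e * a; last by nra.
  have : 4 * r <= e * (r * z) ^+ 2 by rewrite exprMn; nra.
  by nra.
rewrite sub0r normrN ger0_norm ?dsigma_ge0//.
have h1 : e^-1 <= r.
  rewrite (le_trans _ (_ : n%:R <= r)) ?ler_nat//.
  by near: n; exact: nbhs_infty_ger.
have : expR (r * z) <= 1 by rewrite -expR0 ler_expR; nra.
rewrite /dsigma; set a := expR _ in a0 * => a1.
rewrite ler_pdivrMr ?addr_gt0//.
have : 1 <= r * e by rewrite -ler_pdivrMr// div1r.
by nra.
Unshelve. all: by end_near. Qed.

End activation.

(** * The network, its directional derivative, and uniform bounds *)

Section network_derivative.
Context {R : realType} {H : nat}.
Implicit Types (s ds : R -> R) (phi psi u v : 'rV[R]_(3 * H).+1) (x z M : R).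

Definition net s phi x : R :=
  coord phi (3 * H + 1) +
  \sum_(1 <= j < H.+1)
     coord phi (2 * H + j) * s (coord phi j * x + coord phi (H + j)).

(* The derivative of [net s] at [phi] in the direction [u], when [ds] is the
   derivative of [s]. *)
Definition dnet s ds phi u x : R :=
  coord u (3 * H + 1) +
  \sum_(1 <= j < H.+1)
     (coord u (2 * H + j) * s (coord phi j * x + coord phi (H + j)) +
      coord phi (2 * H + j) *
        (ds (coord phi j * x + coord phi (H + j)) *
         (coord u j * x + coord u (H + j)))).

Lemma coordP (a : R) u v k : coord (a *: u + v) k = a * coord u k + coord v k.
Proof. by rewrite /coord !mxE. Qed.

Lemma dnet_linear s ds phi (a : R) u v x :
  dnet s ds phi (a *: u + v) x = a * dnet s ds phi u x + dnet s ds phi v x.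
Proof.
rewrite /dnet mulrDr mulr_sumr addrACA -big_split/= coordP; congr (_ + _).
by apply: eq_bigr => j _; rewrite !coordP; ring.
Qed.

(** Proved at every point h of the line, not only at h = 0, because differentiating under the
    integral requires the derivative on a whole interval. *)
Lemma net_is_derive s ds phi u x (h : R) : (forall z, is_derive z 1 s (ds z)) ->
  is_derive h 1 (fun h : R => net s (h *: u + phi) x)
    (dnet s ds (h *: u + phi) u x).
Proof.
move=> sE.
have dc k : is_derive h 1 (fun h : R => coord (h *: u + phi) k) (coord u k).
  rewrite (_ : (fun _ => _) = (coord u k \*: id) + cst (coord phi k)).
    have := is_deriveD (is_deriveZ (coord u k) (is_derive_id h (1 : R)))
      (is_derive_cst (coord phi k) h 1).
    by rewrite /GRing.scale/= mulr1 addr0.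
  by apply/funext => t; rewrite coordP mulrC.
have dterm j : is_derive h 1
   (fun h : R => coord (h *: u + phi) (2 * H + j) *
      s (coord (h *: u + phi) j * x + coord (h *: u + phi) (H + j)))
   (coord u (2 * H + j) *
      s (coord (h *: u + phi) j * x + coord (h *: u + phi) (H + j)) +
    coord (h *: u + phi) (2 * H + j) *
      (ds (coord (h *: u + phi) j * x + coord (h *: u + phi) (H + j)) *
       (coord u j * x + coord u (H + j)))).
  have d1 : is_derive h 1
      (fun h : R => coord (h *: u + phi) j * x + coord (h *: u + phi) (H + j))
      (coord u j * x + coord u (H + j)).
    have := is_deriveD (is_deriveM (dc j) (is_derive_cst x h 1)) (dc (H + j)%N).
    by rewrite /GRing.scale/= mulr0 add0r [x * _]mulrC.
  have d2 := is_derive1_comp d1 (sE _).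
  have := is_deriveM (dc (2 * H + j)%N) d2.
  by rewrite /GRing.scale/= addrC [s _ * _]mulrC.
have dsum : forall r : seq nat, is_derive h 1
   (fun h : R => \sum_(j <- r) coord (h *: u + phi) (2 * H + j) *
      s (coord (h *: u + phi) j * x + coord (h *: u + phi) (H + j)))
   (\sum_(j <- r) (coord u (2 * H + j) *
      s (coord (h *: u + phi) j * x + coord (h *: u + phi) (H + j)) +
    coord (h *: u + phi) (2 * H + j) *
      (ds (coord (h *: u + phi) j * x + coord (h *: u + phi) (H + j)) *
       (coord u j * x + coord u (H + j))))).
  elim=> [|j r IH].
    rewrite big_nil (_ : (fun _ => _) = cst 0); first exact: is_derive_cst.
    by apply/funext => t; rewrite big_nil.
  rewrite big_cons; have := is_deriveD (dterm j) IH.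
  congr (is_derive _ _ _ _).
  by apply/funext => t; rewrite big_cons.
exact: is_deriveD (dc _) (dsum _).
Qed.

(** A common bound for [net] and [dnet] on [0,1] when all coordinates are at most M in absolute
    value. Preactivations are then at most 2 M, so a neuron contributes at most M (1 + 2 M) to [net]
    and M (1 + 2 M) + M (2 M) to [dnet]. It does not depend on the activation, hence not on r. *)
Definition net_bound M : R := M + H%:R * (2 * M * (1 + 2 * M)).

Lemma sum_bound (F : nat -> R) (c : R) :
  (forall j, `|F j| <= c) -> `|\sum_(1 <= j < H.+1) F j| <= H%:R * c.
Proof.
move=> Fc; rewrite (le_trans (ler_norm_sum _ _ _))//.
rewrite (le_trans (ler_sum _ (fun j _ => Fc j)))//.
by rewrite sumr_const_nat subn1/= mulr_natl.
Qed.

Section bounds.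
Variables (s ds : R -> R) (phi u : 'rV[R]_(3 * H).+1) (x M : R).
Hypotheses (sP : admissible s ds) (x01 : x \in `[0, 1]).
Hypotheses (phiM : forall k, `|coord phi k| <= M).
Hypotheses (uM : forall k, `|coord u k| <= M).

Let M0 : 0 <= M. Proof. exact: le_trans (phiM 0%N). Qed.

Let aff_bound v : (forall k, `|coord v k| <= M) ->
  forall j, `|coord v j * x + coord v (H + j)| <= 2 * M.
Proof.
move=> vM j; rewrite mulr_natl mulr2n (le_trans (ler_normD _ _))// lerD//.
move: x01; rewrite in_itv/= => /andP[x0 x1].
by rewrite normrM (ger0_norm x0) (le_trans (ler_piMr _ x1)).
Qed.

Let s_bound j : `|s (coord phi j * x + coord phi (H + j))| <= 1 + 2 * M.
Proof. by have [_ _ h _] := sP; rewrite (le_trans (h _))// lerD2l aff_bound. Qed.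

Lemma net_le : `|net s phi x| <= net_bound M.
Proof.
rewrite (le_trans (ler_normD _ _))// lerD//; apply: sum_bound => j.
rewrite normrM ler_pM// (le_trans (phiM _))//.
by rewrite mulr_natl mulr2n lerDl.
Qed.

Lemma dnet_le : `|dnet s ds phi u x| <= net_bound M.
Proof.
rewrite (le_trans (ler_normD _ _))// lerD//; apply: sum_bound => j.
rewrite (le_trans (ler_normD _ _))//.
rewrite (_ : 2 * M * _ = M * (1 + 2 * M) + M * (1 + 2 * M)); last by ring.
rewrite lerD// normrM ler_pM//.
have [_ _ _ h] := sP.
rewrite normrM -[leRHS]mul1r ler_pM// (le_trans (aff_bound uM _))//.
by rewrite lerDr.
Qed.

End bounds.

Lemma measurable_net s ds phi : admissible s ds ->
  measurable_fun setT (net s phi).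
Proof.
move=> [ms mds _ _]; apply: measurable_funD => //; apply: measurable_sum => j.
apply: measurable_funM => //; apply: measurableT_comp => //.
by apply: measurable_funD => //; exact: measurable_funM.
Qed.

Lemma measurable_dnet s ds phi u : admissible s ds ->
  measurable_fun setT (dnet s ds phi u).
Proof.
move=> [ms mds _ _]; apply: measurable_funD => //; apply: measurable_sum => j.
have maff v : measurable_fun setT (fun x => coord v j * x + coord v (H + j)).
  by apply: measurable_funD => //; exact: measurable_funM.
apply: measurable_funD; apply: measurable_funM => //.
  exact: measurableT_comp.
by apply: measurable_funM => //; exact: measurableT_comp.
Qed.

Lemma net_cvg (s_ : nat -> R -> R) s phi x :
  (forall z, s_ n z @[n --> \oo] --> s z) ->
  net (s_ n) phi x @[n --> \oo] --> net s phi x.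
Proof.
move=> sc; apply: cvgD; first exact: cvg_cst.
by apply: cvg_big => [|j _]; [exact: add_continuous|apply: cvgM; [exact: cvg_cst|]].
Qed.

Lemma dnet_cvg (s_ ds_ : nat -> R -> R) s ds phi u x :
  (forall z, s_ n z @[n --> \oo] --> s z) ->
  (forall z, ds_ n z @[n --> \oo] --> ds z) ->
  dnet (s_ n) (ds_ n) phi u x @[n --> \oo] --> dnet s ds phi u x.
Proof.
move=> sc dsc; apply: cvgD; first exact: cvg_cst.
apply: cvg_big => [|j _]; first exact: add_continuous.
apply: cvgD; apply: cvgM; [exact: cvg_cst|by []|exact: cvg_cst|].
by apply: cvgM => //; exact: cvg_cst.
Qed.

End network_derivative.

Arguments net_bound {R} H M.

(** * Integrals of bounded measurable functions over [0,1] *)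

Section unit_interval_integral.
Context {R : realType}.
Implicit Types (f g : R -> R) (c : R).

(** Unlike integrability, this condition is stable under products. *)
Definition bounded01 f := measurable_fun setT f /\
  exists c, forall x, x \in `[0, 1] -> `|f x| <= c.

Lemma bounded01_integrable f : bounded01 f ->
  (@lebesgue_measure R).-integrable `[0, 1] (EFin \o f).
Proof.
move=> [mf [c fc]]; apply: measurable_bounded_integrable => //.
- by rewrite /= lebesgue_measure_itv/=; case: ifP => _; rewrite ?ltry.
- exact: measurable_funTS.
- exists c; split; first exact: num_real.
  by move=> M cM x /= x01; rewrite (le_trans (fc x _))// ltW.
Qed.

Lemma bounded01_cst c : bounded01 (cst c).
Proof. by split => //; exists `|c|. Qed.

Lemma bounded01D f g : bounded01 f -> bounded01 g -> bounded01 (f \+ g).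
Proof.
move=> [mf [c fc]] [mg [d gd]]; split; first exact: measurable_funD.
by exists (c + d) => x x01; rewrite (le_trans (ler_normD _ _))// lerD ?fc ?gd.
Qed.

Lemma bounded01M f g : bounded01 f -> bounded01 g -> bounded01 (f \* g).
Proof.
move=> [mf [c fc]] [mg [d gd]]; split; first exact: measurable_funM.
by exists (c * d) => x x01; rewrite /= normrM ler_pM ?fc ?gd.
Qed.

Definition int01 f : R := Rintegral (@lebesgue_measure R) `[0, 1] f.

Lemma int01D f g : bounded01 f -> bounded01 g ->
  int01 (f \+ g) = int01 f + int01 g.
Proof. by move=> bf bg; apply: RintegralD => //; exact: bounded01_integrable. Qed.

Lemma int01Z c f : bounded01 f -> int01 (fun x => c * f x) = c * int01 f.
Proof. by move=> bf; apply: RintegralZl => //; exact: bounded01_integrable. Qed.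

Lemma int01_cst c : int01 (cst c) = c.
Proof.
rewrite /int01 Rintegral_cst//= lebesgue_measure_itv/= lte_fin ltr01.
by rewrite oppr0 adde0 mulr1.
Qed.

Lemma eq_int01 f g : {in `[0, 1], f =1 g} -> int01 f = int01 g.
Proof. by move=> fg; apply: eq_Rintegral => x; rewrite inE/=; exact: fg. Qed.

Lemma le_int01 f g : bounded01 f -> bounded01 g ->
  {in `[0, 1], forall x, f x <= g x} -> int01 f <= int01 g.
Proof.
move=> bf bg fg; apply: le_Rintegral => //; by [exact: bounded01_integrable|].
Qed.

Lemma int01_ge0 f : (forall x, 0 <= f x) -> 0 <= int01 f.
Proof. by move=> f0; exact: Rintegral_ge0. Qed.

(* Cauchy-Schwarz, with the second factor bounded pointwise; obtained by
   integrating the square [(2 k f - J g)^2]. *)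
Lemma int01_sqr_le f g k : bounded01 f -> bounded01 g ->
  {in `[0, 1], forall x, g x ^+ 2 <= k} ->
  int01 (fun x => 2 * (f x * g x)) ^+ 2 <= 4 * k * int01 (fun x => f x ^+ 2).
Proof.
move=> bf bg gk; set J := int01 _; set L := int01 (fun x => f x ^+ 2).
have bf2 : bounded01 (fun x => f x ^+ 2) by exact: bounded01M.
have bg2 : bounded01 (fun x => g x ^+ 2) by exact: bounded01M.
have bfg : bounded01 (fun x => 2 * (f x * g x)).
  by apply: bounded01M; [exact: bounded01_cst|exact: bounded01M].
have bZ c h : bounded01 h -> bounded01 (fun x => c * h x).
  by move=> bh; apply: bounded01M => //; exact: bounded01_cst.
have L0 : 0 <= L by apply: int01_ge0 => x; exact: sqr_ge0.
have k0 : 0 <= k.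
  by rewrite (le_trans (sqr_ge0 (g 0)))// gk// in_itv/= lexx ler01.
have gk' : int01 (fun x => g x ^+ 2) <= k.
  by rewrite -[leRHS]int01_cst; apply: le_int01 => //; exact: bounded01_cst.
have expand c : int01 (fun x => (2 * k * f x - c * g x) ^+ 2) =
    4 * k ^+ 2 * L + - (2 * k * c) * J + c ^+ 2 * int01 (fun x => g x ^+ 2).
  rewrite -!int01Z// -!int01D//; try by [exact: bZ | apply: bounded01D; exact: bZ].
  by apply: eq_int01 => x _ /=; ring.
have key := int01_ge0 (fun x => sqr_ge0 (2 * k * f x - J * g x)).
rewrite expand {expand} in key.
(* The expanded square reads 0 <= 4 k^2 L - 2 k J^2 + J^2 I with I the integral of g^2; I <= k
   absorbs half of the middle term. *)
have {gk'}key : k * J ^+ 2 <= k * (4 * k * L).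
  have : J ^+ 2 * int01 (fun x => g x ^+ 2) <= J ^+ 2 * k.
    by rewrite ler_wpM2l ?sqr_ge0.
  move: key; set I := int01 _ => ? ?; nra.
have [k_gt0|] := ltP 0 k; first by move: key; rewrite ler_pM2l.
(* Division by k is impossible here, but k = 0 forces g = 0 on [0,1] and so J = 0. *)
move=> kle0; have kE : k = 0 by apply/eqP; rewrite eq_le k0 kle0.
suff -> : J = 0 by rewrite kE expr2 !mulr0 mul0r.
rewrite -[RHS](int01_cst 0); apply: eq_int01 => x /gk; rewrite kE => g0.
have : g x == 0 by rewrite -sqrf_eq0 eq_le g0 sqr_ge0.
by move=> /eqP ->; rewrite !mulr0.
Qed.

End unit_interval_integral.

(** * The risk gradients and their limit as r tends to infinity *)

Section risk_gradient.
Context {R : realType} {H : nat}.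
Implicit Types (s ds : R -> R) (phi psi u v : 'rV[R]_(3 * H).+1).
Variable alpha : R.

Lemma coord_le_norm phi k : `|coord phi k| <= `|phi|.
Proof.
rewrite [leRHS]/Num.norm/= mx_normrE.
exact: (le_bigmax _ (fun ij => `|phi ij.1 ij.2|) (ord0, inord k.-1)).
Qed.

Lemma net_bounded01 s ds phi : admissible s ds -> bounded01 (net s phi).
Proof.
move=> sP; split; first exact: measurable_net sP.
exists (net_bound H `|phi|) => x x01.
by apply: (net_le sP) => //; exact: coord_le_norm.
Qed.

Lemma dnet_bounded01 s ds phi u : admissible s ds -> bounded01 (dnet s ds phi u).
Proof.
move=> sP; split; first exact: measurable_dnet.
exists (net_bound H (`|phi| + `|u|)) => x x01; apply: dnet_le => //.
  by move=> k; rewrite (le_trans (coord_le_norm _ _))// lerDl.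
by move=> k; rewrite (le_trans (coord_le_norm _ _))// lerDr.
Qed.

Definition error s phi x : R := net s phi x - alpha.

Lemma error_bounded01 s ds phi : admissible s ds -> bounded01 (error s phi).
Proof.
move=> sP; apply: bounded01D; first exact: net_bounded01 sP.
exact: (bounded01_cst (- alpha)).
Qed.

(** The chain rule for the squared error, taken under the integral. For the smooth activations
    [derive_risk] shows that it is the true directional derivative; for the ReLU it serves as a
    formal one. *)
Definition drisk s ds phi u : R :=
  int01 (fun x => 2 * (error s phi x * dnet s ds phi u x)).

Lemma drisk_integrand_bounded01 s ds phi u : admissible s ds ->
  bounded01 (fun x => 2 * (error s phi x * dnet s ds phi u x)).
Proof.
move=> sP; apply: bounded01M; first exact: bounded01_cst.
by apply: bounded01M; [exact: error_bounded01 sP|exact: dnet_bounded01].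
Qed.

Lemma drisk_linear s ds phi (a : R) u v : admissible s ds ->
  drisk s ds phi (a *: u + v) = a * drisk s ds phi u + drisk s ds phi v.
Proof.
move=> sP; rewrite /drisk -int01Z; last exact: drisk_integrand_bounded01.
rewrite -int01D; last 2 first.
- apply: bounded01M; first exact: bounded01_cst.
  exact: drisk_integrand_bounded01.
- exact: drisk_integrand_bounded01.
by apply: eq_int01 => x _ /=; rewrite dnet_linear; ring.
Qed.

(** Differentiation under the integral along h u + phi for -1 < h < 1: there all coordinates are
    bounded by |phi| + |u|, so a constant dominates the partial derivative in h. *)
Lemma derive_risk s ds phi u : admissible s ds ->
  (forall z : R, is_derive z 1 s (ds z)) ->
  derive (fun psi => int01 (fun x => error s psi x ^+ 2)) phi u =
  drisk s ds phi u.
Proof.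
move=> sP sE.
pose M := `|phi| + `|u|.
pose f (h : R) x := error s (h *: u + phi) x ^+ 2.
have cM (h : R) k : -1 < h < 1 -> `|coord (h *: u + phi) k| <= M.
  move=> /andP[h1 h2]; rewrite coordP addrC (le_trans (ler_normD _ _))//.
  rewrite lerD ?coord_le_norm// normrM (le_trans _ (coord_le_norm u k))//.
  by rewrite ler_piMl// ltW// ltr_norml h1.
have uM k : `|coord u k| <= M by rewrite (le_trans (coord_le_norm u k))// lerDr.
have M0 : 0 <= M by rewrite addr_ge0.
have nb0 : 0 <= net_bound H M.
  by rewrite addr_ge0// !mulr_ge0// addr_ge0// mulr_ge0.
have df (h x : R) : is_derive h 1 (f ^~ x)
    (2 * (error s (h *: u + phi) x * dnet s ds (h *: u + phi) u x)).
  have := is_deriveX 2 (is_deriveB (net_is_derive phi u x h sE)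
    (is_derive_cst alpha h 1)).
  by rewrite subr0 expr1 /GRing.scale/= -mulrA.
pose C := 2 * ((net_bound H M + `|alpha|) * net_bound H M).
have fP (h : R) : h \in `]-1, 1[ -> bounded01 (f h).
  by move=> _; apply: bounded01M; exact: error_bounded01 sP.
have C_ub (h x : R) : `](-1 : R), 1[%classic h -> `[(0 : R), 1]%classic x -> `|partial1of2 f h x| <= C.
  rewrite /= => h1 x01; rewrite partial1of2E (@derive_val _ _ _ _ _ _ _ (df h x)).
  have nb := net_le sP x01 (fun k => cM h k h1).
  have db := dnet_le sP x01 (fun k => cM h k h1) uM.
  rewrite normrM ger0_norm// ler_pM2l// normrM ler_pM//.
  by rewrite (le_trans (ler_normB _ _))// lerD2r.
have I0 : `](-1 : R), 1[%classic 0 by rewrite /= in_itv/= ltrN10 ltr01.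
have C0 : 0 <= C by rewrite !mulr_ge0// addr_ge0.
have intf (h : R) : `](-1 : R), 1[%classic h ->
    (@lebesgue_measure R).-integrable `[0, 1] (EFin \o f h).
  by move=> h1; exact/bounded01_integrable/fP.
have intC : (@lebesgue_measure R).-integrable `[0, 1] (EFin \o cst C).
  exact/bounded01_integrable/bounded01_cst.
have mB : measurable (`[(0 : R), 1]%classic : set (measurableTypeR R)) by [].
have := cvg_differentiation_under_integral mB I0 intf
  (fun h x _ _ => let: DeriveDef d _ := df h x in d) (fun=> C0) intC C_ub.
move=> cv; apply/cvg_lim => //.
have E0 : f 0 = (fun x => error s phi x ^+ 2).
  by apply/funext => x; rewrite /f scale0r add0r.
have -> : drisk s ds phi u = int01 (partial1of2 f 0).
  apply: eq_int01 => x _; rewrite partial1of2E (@derive_val _ _ _ _ _ _ _ (df 0 x)).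
  by rewrite scale0r add0r.
(* The difference quotients defining [derive] at [phi] are those of the integral of [f h] at h =
   0. *)
apply: cvg_trans cv; apply: near_eq_cvg; near=> h.
by rewrite /= addr0 E0.
Unshelve. all: by end_near. Qed.

(** Dominated convergence: the integrands converge pointwise, and the bounds in [admissible] yield
    one constant C for all n. *)
Lemma drisk_cvg (s_ ds_ : nat -> R -> R) s ds phi u :
  (forall n, admissible (s_ n) (ds_ n)) -> admissible s ds ->
  (forall z, s_ n z @[n --> \oo] --> s z) ->
  (forall z, ds_ n z @[n --> \oo] --> ds z) ->
  drisk (s_ n) (ds_ n) phi u @[n --> \oo] --> drisk s ds phi u.
Proof.
move=> snP sP sc dsc.
pose M := `|phi| + `|u|.
have phiM k : `|coord phi k| <= M by rewrite (le_trans (coord_le_norm _ _))// lerDl.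
have uM k : `|coord u k| <= M by rewrite (le_trans (coord_le_norm _ _))// lerDr.
pose C := 2 * ((net_bound H M + `|alpha|) * net_bound H M).
pose D : set (measurableTypeR R) := `[(0 : R), 1]%classic.
have mD : measurable D by exact: measurable_itv.
pose g s' ds' x := 2 * (error s' phi x * dnet s' ds' phi u x).
have mg s' ds' : admissible s' ds' ->
    measurable_fun D (fun x => (g s' ds' x)%:E).
  move=> sP'; apply/measurable_EFinP/measurable_funTS.
  by have [] := drisk_integrand_bounded01 phi u sP'.
have gc x : (g (s_ n) (ds_ n) x)%:E @[n --> \oo] --> (g s ds x)%:E.
  apply: cvg_EFin; first exact: nearW.
  apply: cvgM; first exact: cvg_cst.
  apply: cvgM; last exact: dnet_cvg.
  by apply: cvgB; [exact: net_cvg|exact: cvg_cst].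
have gC x n : D x -> `|g (s_ n) (ds_ n) x| <= C.
  move=> x01; have nb := net_le (snP n) x01 phiM.
  have db := dnet_le (snP n) x01 phiM uM.
  rewrite normrM ger0_norm// ler_pM2l// normrM ler_pM//.
  by rewrite (le_trans (ler_normB _ _))// lerD2r.
pose mu := @lebesgue_measure R.
have gc_ae : {ae mu, forall x, D x ->
    (g (s_ n) (ds_ n) x)%:E @[n --> \oo] --> (g s ds x)%:E}.
  by apply: aeW => x _; exact: gc.
have gC_ae : {ae mu, forall x n, D x ->
    (`|(g (s_ n) (ds_ n) x)%:E| <= (EFin \o cst C) x)%E}.
  by apply: aeW => x n Dx; rewrite lee_fin; exact: gC.
have [_ _ cv] := dominated_convergence mD (fun n => mg _ _ (snP n)) (mg _ _ sP)
  gc_ae (bounded01_integrable (bounded01_cst C)) gC_ae.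
apply: fine_cvg; rewrite fineK; first exact: cv.
apply: integrable_fin_num => //; apply: bounded01_integrable.
exact: drisk_integrand_bounded01.
Qed.

Definition risk_limit_gradient phi : 'rV[R]_(3 * H).+1 :=
  \row_i drisk (sigma +oo%E) heaviside phi (delta_mx ord0 i).

Lemma risk_gradients_cvg phi :
  risk_gradients alpha phi n @[n --> \oo] --> risk_limit_gradient phi.
Proof.
apply/cvg_ballP => e e0.
have h (i : 'I_(3 * H).+1) : \forall n \near \oo,
    ball (risk_limit_gradient phi ord0 i) e (risk_gradients alpha phi n ord0 i).
  have := @drisk_cvg (fun n => sigma n.+1%:R%:E) (fun n => dsigma n.+1%:R)
    (sigma +oo%E) heaviside phi (delta_mx ord0 i).
  move=> /(_ _ relu_admissible sigma_cvg dsigma_cvg) cv.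
  have {}cv : risk_gradients alpha phi n ord0 i @[n --> \oo] -->
      risk_limit_gradient phi ord0 i.
    rewrite mxE; apply: cvg_trans (cv _); last first.
      by move=> n; apply: sigma_admissible; rewrite ler1n.
    apply: near_eq_cvg; near=> n; rewrite mxE.
    apply/esym/derive_risk => [|z]; last exact: sigma_derive.
    by apply: sigma_admissible; rewrite ler1n.
  by move/cvg_ballP : cv => /(_ _ e0).
(* There are only finitely many entries, so entrywise closeness for large n is simultaneous. *)
near=> n; split=> // i j; rewrite ord1; move: j; near: n.
exact: filter_forall.
Unshelve. all: by end_near. Qed.

(** The gradients converge at every [phi], so the conditional constraint on [G] determines it
    everywhere. *)
Lemma generalized_gradientE (G : 'rV[R]_(3 * H).+1 -> 'rV[R]_(3 * H).+1) phi :
  generalized_gradient alpha G -> G phi = risk_limit_gradient phi.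
Proof.
have cv := risk_gradients_cvg (phi := phi).
move=> /(_ phi) ->; first by apply/cvg_lim => //; exact: norm_hausdorff.
by apply/cvg_ex; exists (risk_limit_gradient phi).
Qed.

End risk_gradient.

(** * Cauchy-Schwarz one coordinate at a time, and coordinates grouped by neuron *)

Lemma CauchySchwarz_step (R : realFieldType) (A B C a b k : R) :
  0 <= A -> 0 <= B -> C ^+ 2 <= A * B -> b ^+ 2 <= k ->
  (C + a * b) ^+ 2 <= (A + a ^+ 2) * (B + k).
Proof.
move=> A0 B0 CAB bk.
apply: (@le_trans _ _ ((A + a ^+ 2) * (B + b ^+ 2))); last first.
  by rewrite ler_wpM2l ?lerD2l// addr_ge0 ?sqr_ge0.
(* Only the cross term matters. Its square is at most 4 A B a^2 b^2, and (A b^2 + B a^2)^2 exceeds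
   that by (A b^2 - B a^2)^2. *)
suff : 2 * (C * (a * b)) <= A * b ^+ 2 + B * a ^+ 2 by nra.
have P0 : 0 <= A * b ^+ 2 by rewrite mulr_ge0 ?sqr_ge0.
have Q0 : 0 <= B * a ^+ 2 by rewrite mulr_ge0 ?sqr_ge0.
apply: le_trans (ler_norm _) _.
rewrite -(@ler_pXn2r _ 2) ?nnegrE ?addr_ge0// real_normK ?num_real//.
have : C ^+ 2 * (a * b) ^+ 2 <= A * B * (a * b) ^+ 2 by rewrite ler_wpM2r ?sqr_ge0.
have := sqr_ge0 (A * b ^+ 2 - B * a ^+ 2).
by move=> ? ?; nra.
Qed.

(** Separates the output bias and collects, for each neuron, its inner weight, inner bias and outer
    weight. [E] is indexed from 1, ordinals from 0. *)
Lemma sum_coord (V : nmodType) (H : nat) (E : nat -> V) :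
  \sum_(i < (3 * H).+1) E i.+1 =
  E (3 * H + 1)%N + \sum_(1 <= j < H.+1) (E j + E (H + j)%N + E (2 * H + j)%N).
Proof.
rewrite -(big_mkord xpredT (fun i => E i.+1)) -(big_add1 _ _ 0 (3 * H).+2 xpredT E).
rewrite big_nat_recr//= addn1 addrC; congr (_ + _).
rewrite (@big_cat_nat _ _ _ H.+1)//=; last by rewrite ltnS leq_pmull.
rewrite (@big_cat_nat _ _ _ (2 * H).+1 H.+1)//=; last 2 first.
- by rewrite ltnS leq_pmull.
- by rewrite ltnS leq_mul2r orbT.
rewrite -[X in \sum_(X <= _ < (2 * H).+1) _]add1n big_addn.
rewrite -[X in \sum_(X <= _ < (3 * H).+1) _]add1n big_addn.
have -> : ((2 * H).+1 - H = H.+1)%N by lia.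
have -> : ((3 * H).+1 - 2 * H = H.+1)%N by lia.
rewrite addrA -!big_split/=.
by apply: eq_bigr => j _; rewrite [(j + H)%N]addnC [(j + _)%N]addnC.
Qed.

(** * Descent of the Lyapunov function in one gradient step *)

Section descent.
Context {R : realType} {H : nat}.
Implicit Types (phi u v : 'rV[R]_(3 * H).+1).
Variable alpha : R.
Let relu : R -> R := sigma +oo%E.
Let J phi u := drisk alpha relu heaviside phi u.
Let g phi := risk_limit_gradient alpha phi.
Let L phi := risk alpha +oo%E phi.
(** The direction of the output bias: ordinal 3H is coordinate 3H + 1. *)
Let e : 'rV[R]_(3 * H).+1 := delta_mx ord0 (inord (3 * H)).

Definition sqnorm u : R := \sum_i u ord0 i ^+ 2.

Lemma sqnormE u : sqnorm u = coord u (3 * H + 1) ^+ 2 +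
  \sum_(1 <= j < H.+1)
    (coord u j ^+ 2 + coord u (H + j) ^+ 2 + coord u (2 * H + j) ^+ 2).
Proof.
rewrite -(sum_coord H (fun k => coord u k ^+ 2)); apply: eq_bigr => i _.
by rewrite /coord/= inord_val.
Qed.

Lemma lyapunovE u :
  lyapunov alpha u = sqnorm u + (coord u (3 * H + 1) - 2 * alpha) ^+ 2.
Proof. by rewrite /lyapunov sqr_sqrtr// sumr_ge0// => i _; exact: sqr_ge0. Qed.

(** Euler's identity for the positively homogeneous ReLU; it holds at 0 as well, which makes
    [dnet_diag] exact at every [phi]. *)
Lemma reluE z : relu z = heaviside z * z.
Proof.
rewrite /relu /sigma /heaviside.
by case: (leP z 0) => z0; rewrite ?mul0r ?mul1r.
Qed.

Lemma relu_sqr_le z : relu z ^+ 2 <= z ^+ 2.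
Proof.
rewrite reluE /heaviside; case: (0 < z); rewrite ?mul1r// mul0r expr0n.
exact: sqr_ge0.
Qed.

Lemma heaviside_sqr_le z (a : R) : (a * heaviside z) ^+ 2 <= a ^+ 2.
Proof.
rewrite /heaviside; case: (0 < z); rewrite ?mulr1// mulr0 expr0n.
exact: sqr_ge0.
Qed.

(** [dnet] is the inner product of [u] with a vector having entry 1 for the output bias and, for a
    neuron with preactivation z and outer weight v, entries relu(z), v 1_{z>0} and v 1_{z>0} x.
    Their squares sum to at most z^2 + 2 v^2 <= 2 (w^2 + b^2 + v^2) per neuron. *)
Lemma dnet_sqr_le phi u x : x \in `[0, 1] ->
  dnet relu heaviside phi u x ^+ 2 <= sqnorm u * (1 + 2 * sqnorm phi).
Proof.
rewrite in_itv/= => /andP[x0 x1].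
have x21 : x ^+ 2 <= 1 by rewrite expr_le1.
pose K j := coord phi j ^+ 2 + coord phi (H + j) ^+ 2 + coord phi (2 * H + j) ^+ 2.
pose U j := coord u j ^+ 2 + coord u (H + j) ^+ 2 + coord u (2 * H + j) ^+ 2.
have K0 j : 0 <= K j by rewrite !addr_ge0 ?sqr_ge0.
have U0 j : 0 <= U j by rewrite !addr_ge0 ?sqr_ge0.
pose A (r : seq nat) := coord u (3 * H + 1) ^+ 2 + \sum_(j <- r) U j.
have A0 r : 0 <= A r by rewrite addr_ge0 ?sqr_ge0 ?sumr_ge0.
have B0 (r : seq nat) : 0 <= 1 + 2 * \sum_(j <- r) K j.
  by rewrite addr_ge0// mulr_ge0// sumr_ge0.
(* Arbitrary index lists allow induction on neurons; the output bias of [phi] enters the bound only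
   afterwards, by monotonicity. *)
suff main (r : seq nat) : (coord u (3 * H + 1) + \sum_(j <- r)
     (coord u (2 * H + j) * relu (coord phi j * x + coord phi (H + j)) +
      coord phi (2 * H + j) *
        (heaviside (coord phi j * x + coord phi (H + j)) *
         (coord u j * x + coord u (H + j))))) ^+ 2 <=
    A r * (1 + 2 * \sum_(j <- r) K j).
  apply: le_trans (main _) _; rewrite !sqnormE ler_wpM2l// lerD2l ler_pM2l//.
  by rewrite lerDr sqr_ge0.
elim: r => [|j r IH].
  by rewrite /A !big_nil !addr0 mulr0 addr0 mulr1.
rewrite big_cons addrCA addrC.
set C := coord u (3 * H + 1) + _ in IH *.
set w := coord phi j; set b := coord phi (H + j); set v := coord phi (2 * H + j).
set z := w * x + b.
have zle : z ^+ 2 <= 2 * (w ^+ 2 + b ^+ 2).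
  have : w ^+ 2 * x ^+ 2 <= w ^+ 2 by rewrite ler_piMr ?sqr_ge0.
  have := sqr_ge0 (w * x - b); rewrite /z; nra.
(* Three steps add one neuron: first its outer weight, then its inner bias, then its inner
   weight. *)
have h1 := CauchySchwarz_step (coord u (2 * H + j)) (A0 r) (B0 r) IH
  (le_trans (relu_sqr_le z) zle).
have hb : (v * heaviside z) ^+ 2 <= v ^+ 2 by exact: heaviside_sqr_le.
have hw : (v * heaviside z * x) ^+ 2 <= v ^+ 2.
  by rewrite exprMn (le_trans _ hb)// ler_piMr ?sqr_ge0.
have A1 := addr_ge0 (A0 r) (sqr_ge0 (coord u (2 * H + j))).
have B1 := addr_ge0 (B0 r) (le_trans (sqr_ge0 z) zle).
have h2 := CauchySchwarz_step (coord u (H + j)) A1 B1 h1 hb.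
have A2 := addr_ge0 A1 (sqr_ge0 (coord u (H + j))).
have B2 := addr_ge0 B1 (sqr_ge0 v).
have := CauchySchwarz_step (coord u j) A2 B2 h2 hw.
congr (_ <= _).
  by congr (_ ^+ 2); ring.
by rewrite /A !big_cons /K /U -/w -/b -/v; ring.
Qed.

(** Linearity in the direction reduces [J phi] to its values on the standard basis, which are the
    entries of [g phi]. *)
Lemma driskE phi u : J phi u = \sum_i u ord0 i * g phi ord0 i.
Proof.
have lin := drisk_linear alpha phi _ _ _ relu_admissible.
have J0 : J phi 0 = 0.
  have := lin 1 0 0; rewrite scaler0 addr0 mul1r -/relu -/(J phi 0).
  by move/eqP; rewrite -subr_eq subrr eq_sym => /eqP.
rewrite [in LHS](row_sum_delta u).
elim/big_rec2 : _ => // i y v _ <-.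
by rewrite [LHS]lin mxE.
Qed.

Lemma drisk_sqr_le phi u k :
  (forall x, x \in `[0, 1] -> dnet relu heaviside phi u x ^+ 2 <= k) ->
  J phi u ^+ 2 <= 4 * k * L phi.
Proof.
move=> h; apply: (int01_sqr_le _ _ h); last exact: dnet_bounded01 relu_admissible.
exact: error_bounded01 relu_admissible.
Qed.

Lemma coord_e k : (0 < k <= 3 * H)%N -> coord e k = 0.
Proof.
move=> /andP[k0 kH]; rewrite /coord /e mxE eqxx/=.
case: eqP => // /(congr1 val); rewrite /= !inordK//; lia.
Qed.

Lemma dnet_e phi x : dnet relu heaviside phi e x = 1.
Proof.
rewrite /dnet big_nat big1 ?addr0; last first.
  move=> j /andP[j1 jH]; rewrite !coord_e; try lia.
  by rewrite !mul0r addr0 !mulr0 addr0.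
by rewrite /coord /e mxE addn1/= !eqxx.
Qed.

(** Euler's identity: each neuron term is homogeneous of degree 2 in the parameters, the output bias
    of degree 1. *)
Lemma dnet_diag phi x : dnet relu heaviside phi phi x =
  2 * net relu phi x - coord phi (3 * H + 1).
Proof.
rewrite /dnet /net mulrDr [2 * \sum_(_ <= _ < _) _]mulr_sumr addrAC; congr (_ + _).
  by ring.
by apply: eq_bigr => j _; rewrite -reluE; ring.
Qed.

Lemma risk_ge0 phi : 0 <= L phi.
Proof. by apply: int01_ge0 => x; exact: sqr_ge0. Qed.

(* The left-hand side is half of the inner product of the gradients of
   [lyapunov] and of the limit risk. *)
Lemma gradient_lyapunov phi :
  J phi phi + (coord phi (3 * H + 1) - 2 * alpha) * J phi e = 4 * L phi.
Proof.
rewrite addrC -[LHS](drisk_linear _ _ _ _ _ relu_admissible).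
have b2 : bounded01 (fun x => error alpha relu phi x ^+ 2).
  by apply: bounded01M; exact: error_bounded01 relu_admissible.
rewrite -[RHS](int01Z _ b2); apply: eq_int01 => x _ /=.
by rewrite dnet_linear dnet_e dnet_diag /error; ring.
Qed.

Lemma sqnorm_gradient phi : sqnorm (g phi) = J phi (g phi).
Proof. by rewrite driskE; apply: eq_bigr => i _; rewrite expr2. Qed.

Lemma sqnorm_ge0 u : 0 <= sqnorm u.
Proof. by apply: sumr_ge0 => i _; exact: sqr_ge0. Qed.

(** Testing the Cauchy-Schwarz bound in the direction [g phi] itself gives |g|^4 <= 4 |g|^2 (1 + 2
    |phi|^2) L; divide by |g|^2 unless it vanishes. *)
Lemma sqnorm_gradient_le phi :
  sqnorm (g phi) <= 4 * (1 + 2 * sqnorm phi) * L phi.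
Proof.
have := drisk_sqr_le (@dnet_sqr_le phi (g phi)); rewrite -sqnorm_gradient.
have [->|S0] := eqVneq (sqnorm (g phi)) 0.
  by rewrite !mulr_ge0 ?risk_ge0// addr_ge0// mulr_ge0 ?sqnorm_ge0.
have {}S0 : 0 < sqnorm (g phi) by rewrite lt_neqAle eq_sym S0 sqnorm_ge0.
by rewrite -[X in _ -> is_true X](ler_pM2l S0); congr (_ <= _); ring.
Qed.

(** The Lyapunov function is quadratic, so its second-order expansion is exact; [gradient_lyapunov]
    evaluates the linear term. *)
Lemma lyapunov_step phi (c : R) :
  lyapunov alpha (phi - c *: g phi) - lyapunov alpha phi =
  - (8 * c * L phi) + c ^+ 2 * (sqnorm (g phi) + J phi e ^+ 2).
Proof.
have gE : coord (g phi) (3 * H + 1) = J phi e by rewrite /coord mxE addn1.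
have cE : coord (phi - c *: g phi) (3 * H + 1) =
    coord phi (3 * H + 1) - c * J phi e by rewrite -gE /coord !mxE.
have nE : sqnorm (phi - c *: g phi) =
    sqnorm phi - 2 * c * J phi phi + c ^+ 2 * sqnorm (g phi).
  rewrite driskE /sqnorm !mulr_sumr -sumrN -!big_split/=.
  by apply: eq_bigr => i _; rewrite !mxE; ring.
rewrite !lyapunovE cE nE.
have := gradient_lyapunov phi; move=> /(congr1 (fun t => 2 * c * t)) E.
rewrite (_ : 8 * c * L phi = 2 * c * (4 * L phi)); last by ring.
by rewrite -E; ring.
Qed.

Lemma lyapunov_descent phi (c : R) : 0 < c ->
  c * (4 * lyapunov alpha phi + 2) <= 1 ->
  lyapunov alpha (phi - c *: g phi) - lyapunov alpha phi <= - 4 * c * L phi.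
Proof.
move=> c0 cV; rewrite lyapunov_step.
have SV : sqnorm phi <= lyapunov alpha phi by rewrite lyapunovE lerDl sqr_ge0.
have S0 := sqnorm_ge0 phi; have L0 := risk_ge0 phi.
have h1 := sqnorm_gradient_le phi.
have h2 : J phi e ^+ 2 <= 4 * L phi.
  rewrite -[4]mulr1; apply: drisk_sqr_le => x _.
  by rewrite dnet_e expr1n.
(* The bounds [h1] and [h2] add up to (2 + 2 |phi|^2) 4 L, and 2 + 2 |phi|^2 <= 4 V + 2. *)
have h3 : c * (2 + 2 * sqnorm phi) <= 1.
  by apply: le_trans cV; rewrite ler_pM2l//; nra.
have h4 : c * (sqnorm (g phi) + J phi e ^+ 2) <= 4 * L phi.
  apply: (@le_trans _ _ (c * (2 + 2 * sqnorm phi) * (4 * L phi))).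
    by rewrite -mulrA ler_pM2l//; nra.
  by rewrite ler_piMl// mulr_ge0.
rewrite expr2 -mulrA.
have : c * (c * (sqnorm (g phi) + J phi e ^+ 2)) <= c * (4 * L phi).
  by rewrite ler_pM2l.
by move=> ?; lra.
Qed.

End descent.

(** * Induction along the gradient descent iterates *)

Theorem lemma4p3 (R : realType) (H : nat) (H_gt0 : (0 < H)%N) (alpha : R)
    (G : 'rV[R]_(3 * H).+1 -> 'rV[R]_(3 * H).+1)
    (G_grad : generalized_gradient alpha G)
    (gamma : R) (gamma_gt0 : 0 < gamma)
    (Theta : nat -> 'rV[R]_(3 * H).+1)
    (Theta_step : forall n : nat,
       Theta n.+1 = Theta n - gamma *: G (Theta n))
    (gamma_le : gamma <= (4 * lyapunov alpha (Theta 0%N) + 2)^-1) :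
  forall n : nat,
    lyapunov alpha (Theta n.+1) - lyapunov alpha (Theta n)
      <= - 4 * gamma * risk alpha +oo%E (Theta n) <= 0.
Proof.
have V0 (u : 'rV[R]_(3 * H).+1) : 0 <= lyapunov alpha u.
  by rewrite lyapunovE addr_ge0 ?sqr_ge0 ?sqnorm_ge0.
have decrease_le0 n : - 4 * gamma * risk alpha +oo%E (Theta n) <= 0.
  by rewrite mulNr mulNr oppr_le0 !mulr_ge0 ?risk_ge0// ltW.
have step n : lyapunov alpha (Theta n) <= lyapunov alpha (Theta 0%N) ->
    lyapunov alpha (Theta n.+1) - lyapunov alpha (Theta n)
      <= - 4 * gamma * risk alpha +oo%E (Theta n).
  move=> VnV0; rewrite Theta_step (generalized_gradientE _ G_grad).
  apply: lyapunov_descent => //.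
  have d0 : 0 < 4 * lyapunov alpha (Theta 0%N) + 2.
    by rewrite ltr_wpDl// mulr_ge0.
  apply: (@le_trans _ _ (gamma * (4 * lyapunov alpha (Theta 0%N) + 2))).
    by rewrite ler_pM2l// lerD2r ler_pM2l.
  by rewrite -ler_pdivlMr// div1r.
(* The step-size condition refers to [Theta 0]; it carries over to [Theta n] because V has not
   increased so far. *)
suff Vle n : lyapunov alpha (Theta n) <= lyapunov alpha (Theta 0%N).
  by move=> n; rewrite step ?decrease_le0.
elim: n => // n IH; apply: (le_trans _ IH); rewrite -subr_le0.
exact: le_trans (step n IH) (decrease_le0 n).
Qed.
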